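(* Let $G$ be a finite group having an abelian normal subgroup $A$ with cyclic quotient $G/A$. Then every class-preserving automorphism of $G$ is an inner automorphism.
   Context: An automorphism $\sigma$ of a group $G$ is class-preserving if for every $g\in G$ the image of $g$ under $\sigma$ is conjugate to $g$ in $G$. *)

(* Defs.v *)
From mathcomp Require Import all_boot all_fingroup all_solvable.

Set Implicit Arguments.
Unset Strict Implicit.
Unset Printing Implicit Defensive.

Local Open Scope group_scope.

(* Automorphisms of G are the permutations in Aut G, which are the identity
   outside G; hence the two predicates below only constrain the values on G. *)

Definition class_preserving (gT : finGroupType) (G : {group gT})
    (sigma : {perm gT}) : Prop :=
  forall g : gT, g \in G -> sigma g \in g ^: G.

Definition inner_automorphism (gT : finGroupType) (G : {group gT})
    (sigma : {perm gT}) : Prop :=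
  exists2 x : gT, x \in G & forall g : gT, g \in G -> sigma g = g ^ x.

(* Main.v *)
Require Import Defs.
From mathcomp Require Import all_boot all_fingroup all_solvable.

Local Open Scope group_scope.

(** After composing [sigma] with an inner automorphism we may assume that it
fixes some [t] with [G = A <t>].  Its restriction [f] to [A] then commutes with
the cyclic group [C] of automorphisms of [A] induced by [<t>], and sends each
[a] in [A] into the [C]-orbit of [a]; it remains to see that [f] lies in [C].
Taking [p]-parts reduces this to the case where [C] is a [p]-group, whose
subgroups form a chain.  Given [a] and [b], comparing [f a], [f b] and [f (ab)]
shows that either one element of [C] agrees with [f] at both [a] and [b], or
one of them can be multiplied by an element of the [C]-submodule generated by
the other so that its stabiliser in [C] grows; by induction a common element
exists for every pair.  For an [a] whose stabiliser is smallest, an element of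
[C] agreeing with [f] at [a] then agrees with [f] everywhere. *)

(** Subgroups of a cyclic group are nested as soon as one order divides the other, and here both
    orders are powers of [p]. *)
Lemma cyclic_pgroup_sub_total {gT : finGroupType} {p : nat}
    {C H K : {group gT}} :
  cyclic C -> p.-group C -> H \subset C -> K \subset C ->
  (H \subset K) || (K \subset H).
Proof.
move=> cycC pC sHC sKC.
rewrite -(cardSg_cyclic cycC sHC sKC) -(cardSg_cyclic cycC sKC sHC).
have [[m ->] [n ->]] := (p_natP (pgroupS sHC pC), p_natP (pgroupS sKC pC)).
by case/orP: (leq_total m n) => le_mn; apply/orP; [left | right];
  apply: dvdn_exp2l.
Qed.

Section AutAbelian.

Variables (gT : finGroupType) (A : {group gT}).
Hypothesis abA : abelian A.

Lemma Aut_morphM (s : {perm gT}) :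
  s \in Aut A -> {in A &, {morph s : a b / a * b}}.
Proof. by move=> sA; apply/morphicP/Aut_morphic. Qed.

(* In module notation [(1 + y + ... + y^(n-1)) a], which [y - 1] maps to
   [(y^n - 1) a]. *)
Definition orbit_prod (y : {perm gT}) (n : nat) (a : gT) : gT :=
  \prod_(i < n) (y ^+ i) a.

Lemma orbit_prodS y n a :
  orbit_prod y n.+1 a = orbit_prod y n a * (y ^+ n) a.
Proof. by rewrite /orbit_prod big_ord_recr. Qed.

Lemma orbit_prod_in y n a :
  y \in Aut A -> a \in A -> orbit_prod y n a \in A.
Proof.
move=> yA aA; apply: group_prod => i _.
by apply: (@Aut_closed _ A) => //; rewrite groupX.
Qed.

Lemma orbit_prod_commute s y n a :
    s \in Aut A -> y \in Aut A -> commute s y -> a \in A ->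
  s (orbit_prod y n a) = orbit_prod y n (s a).
Proof.
move=> sA yA csy aA; elim: n => [|n IHn].
  rewrite /orbit_prod !big_ord0; apply: (mulgI (s 1)).
  by rewrite -Aut_morphM ?mulg1.
rewrite !orbit_prodS Aut_morphM ?orbit_prod_in ?IHn //; last first.
  by apply: (@Aut_closed _ A) => //; rewrite groupX.
by rewrite -!permM (commuteX n csy).
Qed.

Lemma orbit_prod_shift y n a :
    y \in Aut A -> a \in A ->
  a * y (orbit_prod y n a) = orbit_prod y n a * (y ^+ n) a.
Proof.
move=> yA aA; have cl m : (y ^+ m) a \in A.
  by apply: (@Aut_closed _ A) => //; rewrite groupX.
elim: n => [|n IHn].
  rewrite /orbit_prod !big_ord0 expg0 perm1 mul1g.
  have: y (1 * 1) = y 1 * y 1 by apply: Aut_morphM.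
  by rewrite mulg1 -{1}[y 1]mulg1 => /mulgI <-; rewrite mulg1.
rewrite orbit_prodS Aut_morphM ?orbit_prod_in // mulgA IHn.
by rewrite expgSr permM.
Qed.

(** Additively, the last hypothesis reads [(y - 1) b = - (y^n - 1) a], which cancels the image of
    the orbit product under [y - 1]. *)
Lemma fix_mul_orbit_prod y n a b :
    y \in Aut A -> a \in A -> b \in A ->
    (y ^+ n) a * y b = a * b ->
  y (b * orbit_prod y n a) = b * orbit_prod y n a.
Proof.
move=> yA aA bA eq_ab; set S := orbit_prod y n a.
have SA : S \in A by apply: orbit_prod_in.
have cl m c : c \in A -> (y ^+ m) c \in A.
  by move=> cA; apply: (@Aut_closed _ A) => //; rewrite groupX.
have ybA : y b \in A by apply: (cl 1%N).
have cA := centsP abA.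
apply: (mulgI a); rewrite Aut_morphM // (cA (y b)) ?(cl 1%N) //.
rewrite mulgA orbit_prod_shift // -mulgA eq_ab.
by rewrite (cA S) ?groupM // mulgA.
Qed.

Definition agree_at (C : {group {perm gT}}) (f : {perm gT}) (a b : gT) : Prop :=
  exists2 c, c \in C & f a = c a /\ f b = c b.

Lemma agree_at_sym C f a b : agree_at C f a b -> agree_at C f b a.
Proof. by case=> c cC []; exists c. Qed.

Section Pgroup.

Variables (p : nat) (C : {group {perm gT}}) (f : {perm gT}).
Hypotheses (cycC : cyclic C) (pC : p.-group C) (sCA : C \subset Aut A).
Hypotheses (fA : f \in Aut A) (cCf : f \in 'C(C)).
Hypothesis f_orb : forall a, a \in A -> exists2 c, c \in C & f a = c a.

(** Since [f] and [c] commute with [y], agreement at [a] forces agreement at [orbit_prod y n a], a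
    factor that then cancels. *)
Lemma agree_at_mul_orbit_prod y n a b :
    y \in C -> a \in A -> b \in A ->
  agree_at C f a (b * orbit_prod y n a) -> agree_at C f a b.
Proof.
move=> yC aA bA [c cC [fa fb]]; have yA := subsetP sCA _ yC.
exists c => //; split=> //; move: fb.
have cA := subsetP sCA _ cC.
have ccy : commute c y by apply: (centsP (cyclic_abelian cycC)).
have cfy : commute f y by apply: (centP cCf).
by rewrite !Aut_morphM ?orbit_prod_in // !orbit_prod_commute // fa => /mulIg.
Qed.

Lemma astab1_C c a : (c \in 'C_C[a | 'P]) = (c \in C) && (c a == a).
Proof.
by rewrite inE; congr andb; apply/astab1P/eqP; rewrite /= apermE.
Qed.

(** The two stabilisers are comparable, and [y] lies only in that of [b]. *)
Lemma astab1_ltn_card y a b :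
    y \in C -> y a <> a -> y b = b ->
  #|'C_C[a | 'P]| < #|'C_C[b | 'P]|.
Proof.
move=> yC ya yb; apply: proper_card; rewrite properE.
have nba : ~~ ('C_C[b | 'P] \subset 'C_C[a | 'P]).
  apply/subsetPn; exists y; rewrite astab1_C yC ?yb ?eqxx //.
  exact/eqP.
have /= := cyclic_pgroup_sub_total cycC pC
  (subsetIl C 'C[a | 'P]) (subsetIl C 'C[b | 'P]).
by rewrite (negPf nba) orbF => ->.
Qed.

Lemma agree_at_pair a b : a \in A -> b \in A -> agree_at C f a b.
Proof.
(* Induction on [d], which drops whenever one of the two stabilisers grows. *)
pose d a b := (#|C| - #|'C_C[a | 'P]| + (#|C| - #|'C_C[b | 'P]|))%N.
have [n] := ubnP (d a b); elim: n a b => // n IHn.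
(* If [y] does not fix [b], then multiplying [b] by [orbit_prod y m a], with
   [m] chosen so that the product is fixed by [y], enlarges its stabiliser. *)
have slide y m a b c :
    (d a b < n.+1)%N -> a \in A -> b \in A -> y \in C -> c \in C ->
    f b = c (y b) -> f a = c ((y ^+ m) a) -> (y ^+ m) a * y b = a * b ->
  agree_at C f a b.
  move=> lt_d aA bA yC cC fb fa eq_ab; have yA := subsetP sCA _ yC.
  have [yb | /eqP nyb] := eqVneq (y b) b.
    exists c; rewrite // fa fb yb; split=> //; congr (c _).
    by move: eq_ab; rewrite yb => /mulIg.
  set b' := b * orbit_prod y m a.
  have yb' : y b' = b' by apply: fix_mul_orbit_prod.
  have b'A : b' \in A by rewrite groupM ?orbit_prod_in.
  apply: (agree_at_mul_orbit_prod y m) => //; apply: IHn => //.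
  have ltK := astab1_ltn_card _ _ _ yC nyb yb'.
  have leK : #|'C_C[b' | 'P]| <= #|C| by rewrite subset_leq_card ?subsetIl.
  move: lt_d; rewrite ltnS; apply: leq_trans; rewrite /d -addnS leq_add2l.
  by apply: ltn_sub2l => //; apply: leq_trans ltK leK.
move=> a b lt_d aA bA.
have [u uC fa] := f_orb _ aA; have [v vC fb] := f_orb _ bA.
have [w wC fab] := f_orb _ (groupM aA bA).
have wA := subsetP sCA _ wC.
(* Dividing out [w], the element that serves [a * b], will leave [x a * y b = a * b]. *)
pose x := u * w^-1; pose y := v * w^-1.
have xC : x \in C by rewrite groupM ?groupV.
have yC : y \in C by rewrite groupM ?groupV.
have {}fa : f a = w (x a) by rewrite -permM mulgKV.
have {}fb : f b = w (y b) by rewrite -permM mulgKV.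
have xaA : x a \in A by apply: (Aut_closed (subsetP sCA _ xC)).
have ybA : y b \in A by apply: (Aut_closed (subsetP sCA _ yC)).
have eq_ab : x a * y b = a * b.
  by apply: (@perm_inj _ w); rewrite -fab !Aut_morphM // fa fb.
(* One of [x] and [y] is a power of the other; the second case follows by exchanging [a] and [b]. *)
have := cyclic_pgroup_sub_total (H := <[x]>) (K := <[y]>) cycC pC.
rewrite !cycle_subG => /(_ xC yC) /orP[] /cycleP[m def].
  by apply: (slide y m a b w); rewrite -?def.
apply: agree_at_sym; apply: (slide x m b a w); rewrite -?def //.
  by rewrite /d addnC.
by rewrite (centsP abA (y b)) // eq_ab (centsP abA a).
Qed.

Lemma pgroup_orbit_preserving :
  exists2 c, c \in C & {in A, f =1 c}.
Proof.
have [a aA min_a] := arg_minnP (fun a => #|'C_C[a | 'P]|) (group1 A).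
have [c cC fa] := f_orb _ aA; exists c => // b bA.
have [c' c'C [f'a f'b]] := agree_at_pair a b aA bA.
have: c * c'^-1 \in 'C_C[a | 'P].
  by rewrite astab1_C groupM ?groupV //= permM -fa f'a permK.
have /orP[sab | sba] := cyclic_pgroup_sub_total cycC pC
  (subsetIl C 'C[a | 'P]) (subsetIl C 'C[b | 'P]).
  move/(subsetP sab); rewrite astab1_C => /andP[_ /eqP].
  by rewrite permM f'b => {1}<-; rewrite permKV.
(* Minimality at [a] makes this inclusion an equality. *)
have /eqP/= <- : 'C_C[b | 'P] == 'C_C[a | 'P] by rewrite eqEcard sba min_a.
rewrite astab1_C => /andP[_ /eqP].
by rewrite permM f'b => {1}<-; rewrite permKV.
Qed.

End Pgroup.

Lemma cyclic_orbit_preserving (C : {group {perm gT}}) (f : {perm gT}) :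
    cyclic C -> C \subset Aut A -> f \in Aut A -> f \in 'C(C) ->
    (forall a, a \in A -> exists2 c, c \in C & f a = c a) ->
  f \in C.
Proof.
(* As [f] is the product of its [p]-parts, each can be placed in [C] separately. *)
move=> cycC sCA fA cCf f_orb; rewrite -(prod_constt f).
apply: group_prod => p _.
pose Cp := 'O_p(C)%G.
have sCpC : Cp \subset C by apply: pcore_sub.
have fpA : f.`_p \in Aut A by apply: groupX.
have [||||||c cC eq_fc] := @pgroup_orbit_preserving p Cp f.`_p.
- exact: cyclicS cycC.
- exact: pcore_pgroup.
- exact: subset_trans sCA.
- exact: fpA.
- by apply: (subsetP (centS sCpC)); apply: groupX.
- move=> a aA; have [c cC fa] := f_orb a aA.
  have ccf : commute f c^-1 by apply: (centP cCf); rewrite groupV.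
  exists c.`_p.
    have sylC := nilpotent_pcore_Hall p (abelian_nil (cyclic_abelian cycC)).
    rewrite (mem_normal_Hall sylC) ?pcore_normal ?p_elt_constt //.
    exact: groupX.
  (* [f c^-1] fixes [a], hence so does its [p]-part, a power of it. *)
  have: (f * c^-1).`_p \in 'C[a | 'P].
    by apply: groupX; apply/astab1P; rewrite /= apermE permM fa permK.
  move/astab1P; rewrite /= apermE (consttM _ ccf) consttV permM => {2}<-.
  by rewrite permKV.
suffices -> : f.`_p = c by apply: (subsetP sCpC).
have cA : c \in Aut A by apply: (subsetP sCA); apply: (subsetP sCpC).
(* Both permutations are the identity outside [A]. *)
apply/permP=> a; have [/eq_fc //| nAa] := boolP (a \in A).
by rewrite (out_Aut fpA) // (out_Aut cA).
Qed.

End AutAbelian.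

Theorem proposition2p7 (gT : finGroupType) (G A : {group gT})
  (nsAG : A <| G) (abA : abelian A) (cycGA : cyclic (G / A))
  (sigma : {perm gT}) (sigmaG : sigma \in Aut G)
  (sigma_cp : class_preserving G sigma) :
  inner_automorphism G sigma.
Proof.
have [sAG nAG] := andP nsAG.
have [t tG defG] : exists2 t, t \in G &
    forall g, g \in G -> exists a i, a \in A /\ g = a * t ^+ i.
  have [xb defGA] := cyclicP cycGA.
  have: xb \in G / A by rewrite defGA cycle_id.
  case/morphimP=> t nAt tG def_xb; exists t => // g gG.
  have: coset A g \in G / A by apply: mem_quotient.
  rewrite defGA def_xb => /cycleP[i]; rewrite -morphX //.
  case/rcoset_kercosetP/rcosetP=> [||a aA ->]; last by exists a, i.
    exact: (subsetP nAG).
  exact: groupX.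
have [h hG sigma_t] : exists2 h, h \in G & sigma t = t ^ h.
  by have /imsetP[h hG ->] := sigma_cp t tG; exists h.
pose tau := sigma * conj_aut G h^-1.
have tauG : tau \in Aut G.
  rewrite groupM // (subsetP (Aut_conj_aut G G)) // mem_morphim ?groupV //.
  exact: (subsetP (normG G)).
have tauE g : g \in G -> tau g = sigma g ^ h^-1.
  move=> gG; rewrite permM conj_autE ?groupV //.
  exact: (Aut_closed sigmaG).
have tau_t : tau t = t by rewrite tauE // sigma_t conjgK.
have tau_cp a : a \in A -> exists i, tau a = a ^ (t ^+ i).
  move=> aA; have aG := subsetP sAG _ aA.
  have /imsetP[k kG def_a] := sigma_cp a aG.
  (* [tau] conjugates [a] by [k * h^-1 = b * t ^+ i], where [b] acts trivially on the abelian group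
     [A]. *)
  have [b [i [bA def_k]]] := defG (k * h^-1) (groupM kG (groupVr hG)).
  exists i; rewrite tauE // def_a -conjgM def_k conjgM; congr (_ ^ _).
  by apply/conjg_fixP/commgP; apply: (centsP abA).
have nAt : t \in 'N(A) by apply: (subsetP nAG).
(* Without this stability [restr_perm A tau] would be the identity by default. *)
have nA_tau : tau \in 'N(A | 'P).
  apply/astabsP=> a /=; rewrite apermE.
  have tauA : {in A, forall a, tau a \in A}.
    by move=> b /[dup] bA /tau_cp[i ->]; rewrite memJ_norm ?groupX.
  have /eqP {1}<- : tau @: A == A.
    rewrite eqEcard card_imset ?leqnn ?andbT; last exact: perm_inj.
    by apply/subsetP=> _ /imsetP[b bA ->]; apply: tauA.
  by rewrite mem_imset //; apply: perm_inj.
pose f := restr_perm A tau; pose ct := conj_aut A t.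
have fE a : a \in A -> f a = tau a by move=> aA; rewrite /f restr_permE.
have ctXE i a : a \in A -> (ct ^+ i) a = a ^ (t ^+ i).
  move=> aA; rewrite /ct -morphX // norm_conj_autE //.
  exact: groupX.
have fA : f \in Aut A by apply: Aut_restr_perm tauG.
have ctA : ct \in Aut A.
  by rewrite (subsetP (Aut_conj_aut A 'N(A))) // mem_morphim.
have ctE a : a \in A -> ct a = a ^ t by move=> aA; rewrite -(ctXE 1%N).
have /cycleP[i def_f] : f \in <[ct]>.
  apply: (@cyclic_orbit_preserving _ A) => //.
  - exact: cycle_cyclic.
  - by rewrite cycle_subG.
  - rewrite cent_cycle; apply/cent1P/permP=> a; rewrite !permM.
    have [aA | nAa] := boolP (a \in A); last first.
      by rewrite !(out_Aut fA, out_Aut ctA).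
    rewrite (fE a) // !ctE ?fE ?memJ_norm //; last first.
      by rewrite -fE // (Aut_closed fA).
    (* [tau] fixes [t], hence commutes with conjugation by [t]. *)
    have := morphJ (autm_morphism tauG) (subsetP sAG _ aA) tG.
    by rewrite /= autmE tau_t.
  move=> a aA; have [i tau_a] := tau_cp a aA.
  by exists (ct ^+ i); rewrite ?mem_cycle // fE // ctXE.
(* Conjugation by [t ^+ i] agrees with [tau] on [A] and on the powers of [t], hence on [G]; the
   factor [h] undoes the passage from [sigma] to [tau]. *)
exists (t ^+ i * h) => [|g gG]; first by rewrite groupM ?groupX.
rewrite conjgM; apply: (canRL (conjgKV h)).
rewrite -tauE //.
have [a [j [aA ->]]] := defG g gG.
have tauM : {in G &, {morph tau : x y / x * y}} by apply: Aut_morphM.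
have aG := subsetP sAG _ aA.
rewrite tauM ?groupX // conjMg -fE // def_f ctXE //; congr (_ * _).
have -> : tau (t ^+ j) = t ^+ j.
  have := morphX (autm_morphism tauG) j tG.
  by rewrite /= autmE tau_t.
by rewrite conjgE (commuteX2 j i (commute_refl t)) mulKg.
Qed.
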